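(* Let $\{(x^t,y^t)\}_{t\ge 0}$ be the iterates produced by the generalized Frank-Wolfe method with dual averaging (described in the context), from any starting points $x^0\in\mathrm{dom}\,h$ and $y^0\in\mathrm{dom}\,f^*$, with the constant step-sizes $\alpha_t=\min\{1/(2\kappa),1\}$ for all $t\ge 0$. Then $$\Delta(x^t,y^t)\le \rho(\kappa)^t\,\Delta(x^0,y^0),\qquad \forall\, t\ge 0,$$ where $\kappa=L\|\mathsf{A}\|^2/\mu$ and the function $\rho:[0,+\infty)\to[0,1)$ is defined by $$\rho(\kappa):=\begin{cases}\kappa, & \text{if } 0\le\kappa\le 1/2,\\ 1-1/(4\kappa), & \text{if }\kappa>1/2.\end{cases}$$
   Context: Setting. $(\mathbb{X},\|\cdot\|_{\mathbb{X}})$ and $(\mathbb{U},\|\cdot\|_{\mathbb{U}})$ are finite-dimensional real normed spaces with dual spaces $(\mathbb{X}^*,\|\cdot\|_{\mathbb{X}^*})$ and $(\mathbb{U}^*,\|\cdot\|_{\mathbb{U}^*})$ (dual norms). $\mathsf{A}:\mathbb{X}\to\mathbb{U}$ is a linear operator with adjoint $\mathsf{A}^*:\mathbb{U}^*\to\mathbb{X}^*$ and operator norm $\|\mathsf{A}\|:=\sup_{\|x\|_{\mathbb{X}}=1}\|\mathsf{A}x\|_{\mathbb{U}}$. $f:\mathbb{U}\to\mathbb{R}$ is convex and differentiable, and its gradient is $L$-Lipschitz for some $L>0$: $\|\nabla f(u)-\nabla f(v)\|_{\mathbb{U}^*}\le L\|u-v\|_{\mathbb{U}}$ for all $u,v\in\mathbb{U}$.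 $h:\mathbb{X}\to\mathbb{R}\cup\{+\infty\}$ is a closed convex function with nonempty domain $\mathrm{dom}\,h:=\{x\in\mathbb{X}:h(x)<+\infty\}$, and it is $\mu$-strongly convex on $\mathrm{dom}\,h$ for some $\mu>0$: for all $x,y\in\mathrm{dom}\,h$ and $\lambda\in[0,1]$, $h(\lambda x+(1-\lambda)y)\le\lambda h(x)+(1-\lambda)h(y)-(\mu/2)\lambda(1-\lambda)\|x-y\|_{\mathbb{X}}^2$. The optimization problem is $\min_{x\in\mathbb{X}} f(\mathsf{A}x)+h(x)$, with condition number $\kappa:=L\|\mathsf{A}\|^2/\mu$ (when $\kappa=0$, $1/(2\kappa)$ is read as $+\infty$, so that $\min\{1/(2\kappa),1\}=1$). Fenchel conjugates: $f^*(y):=\sup_{u\in\mathbb{U}}\langle y,u\rangle-f(u)$ for $y\in\mathbb{U}^*$, with $\mathrm{dom}\,f^*:=\{y\in\mathbb{U}^*: f^*(y)<+\infty\}$, and $h^*(z):=\sup_{x\in\mathrm{dom}\,h}\langle z,x\rangle-h(x)$ for $z\in\mathbb{X}^*$ (real-valued since $h$ is strongly convex). Duality gap: for $x\in\mathrm{dom}\,h$ and $y\in\mathrm{dom}\,f^*$, $\Delta(x,y):=f(\mathsf{A}x)+h(x)+f^*(y)+h^*(-\mathsf{A}^*y)$. Algorithm (generalized Frank-Wolfe method with dual averaging): given $x^0\in\mathrm{dom}\,h$, $y^0\in\mathrm{dom}\,f^*$ and step-sizes $\{\alpha_t\}_{t\ge0}\subseteq(0,1]$, at each iteration $t=0,1,2,\ldots$: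 (1) compute $v^t=\arg\min_{x\in\mathbb{X}}\ \langle\mathsf{A}^*y^t,x\rangle+h(x)$ (the unique minimizer); (2) set $x^{t+1}:=x^t+\alpha_t(v^t-x^t)$; (3) compute $g^t:=\nabla f(\mathsf{A}x^t)$ and set $y^{t+1}:=(1-\alpha_t)y^t+\alpha_t g^t$. *)

(* Defs.v *)
From HB Require Import structures.
From mathcomp Require Import all_boot all_order all_algebra.
From mathcomp Require Import all_classical all_reals all_analysis.
From mathcomp Require Import lra.
Import Order.TTheory GRing.Theory Num.Theory.
Import numFieldNormedType.Exports.

Set Implicit Arguments.
Unset Strict Implicit.
Unset Printing Implicit Defensive.

Local Open Scope classical_set_scope.
Local Open Scope ring_scope.

(* Finite-dimensional normed spaces: the norm is arbitrary.  The dual of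
   [U : finNormedModType R] is ['Hom(U, R^o)], all of whose elements are
   continuous in finite dimension, and the adjoint of [A : 'Hom(X, U)] is
   [y |-> (y \o A)%VF]. *)
#[short(type="finNormedModType")]
HB.structure Definition FinNormedModule (K : numDomainType) :=
  {T of NormedModule K T & Vector K T}.

Section Norms.
Context {R : realType}.

(* If X is trivial, the supremum is that of the empty set, which is 0. *)
Definition opnorm {X U : finNormedModType R} (A : 'Hom(X, U)) : R :=
  sup [set `|A x| | x in [set x : X | `|x| = 1]].

Definition dualnorm {U : finNormedModType R} (y : 'Hom(U, R^o)) : R :=
  sup [set (y u : R) | u in [set u : U | `|u| <= 1]].

Definition adjoint {X U : finNormedModType R} (A : 'Hom(X, U))
  (y : 'Hom(U, R^o)) : 'Hom(X, R^o) := (y \o A)%VF.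

Definition gradient {U : finNormedModType R} (f : U -> R^o) (u : U) :
  'Hom(U, R^o) := linfun ('d f u).

Definition smooth {U : finNormedModType R} (L : R) (f : U -> R^o) : Prop :=
  (forall u, differentiable f u) /\
  (forall u v, dualnorm (gradient f u - gradient f v) <= L * `|u - v|).

End Norms.

Section ExtendedConvex.
Context {R : realType}.
Local Open Scope ereal_scope.

Definition edom {T : Type} (F : T -> \bar R) : set T := [set x | F x < +oo].

Definition epigraph {X : finNormedModType R} (h : X -> \bar R) :
  set (X * R^o) := [set p | h p.1 <= (p.2 : R)%:E].

Definition closed_convex {X : finNormedModType R} (h : X -> \bar R) : Prop :=
  closed (epigraph h) /\
  convex_set (epigraph h : set (convex_lmodType (X * R^o)%type)).

Definition strongly_convex {X : finNormedModType R} (mu : R)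
    (h : X -> \bar R) : Prop :=
  forall x y (l : R), edom h x -> edom h y -> (0 <= l <= 1)%R ->
    h (l *: x + (1 - l) *: y)%R <=
      l%:E * h x + (1 - l)%:E * h y
      - (mu / 2 * l * (1 - l) * `|x - y| ^+ 2)%:E.

Definition conjugate {X : finNormedModType R} (h : X -> \bar R)
    (z : 'Hom(X, R^o)) : \bar R :=
  ereal_sup [set (z x : R)%:E - h x | x in edom h].

Definition argmin {T : Type} (F : T -> \bar R) : set T :=
  [set x | forall x', F x <= F x'].

Definition duality_gap {X U : finNormedModType R} (A : 'Hom(X, U))
    (f : U -> R^o) (h : X -> \bar R) (x : X) (y : 'Hom(U, R^o)) : \bar R :=
  (f (A x) : R)%:E + h x + conjugate (EFin \o f) y
    + conjugate h (- adjoint A y)%R.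

End ExtendedConvex.

Section Algorithm.
Context {R : realType} {X U : finNormedModType R}.

Record gfw_dual_averaging (A : 'Hom(X, U)) (f : U -> R^o) (h : X -> \bar R)
    (alpha : nat -> R) (x0 : X) (y0 : 'Hom(U, R^o))
    (x : nat -> X) (y : nat -> 'Hom(U, R^o)) : Prop := GFWDualAveraging {
  gfw_x0 : x 0%N = x0 ;
  gfw_y0 : y 0%N = y0 ;
  gfw_step : forall t, exists v g,
    [/\ argmin (fun x' : X => (adjoint A (y t) x' : R)%:E + h x')%E v,
        x t.+1 = x t + alpha t *: (v - x t),
        g = gradient f (A (x t)) &
        y t.+1 = (1 - alpha t) *: y t + alpha t *: g] }.

End Algorithm.

Section Rate.
Context {R : realType}.

Definition condition_number {X U : finNormedModType R} (L mu : R)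
  (A : 'Hom(X, U)) : R := L * opnorm A ^+ 2 / mu.

(* In MathComp 1 / 0 = 0, whereas 1 / (2 kappa) is +oo when kappa = 0. *)
Definition stepsize (kappa : R) : R :=
  if kappa == 0 then 1 else Num.min (1 / (2 * kappa)) 1.

Definition rho (kappa : R) : R :=
  if kappa <= 1 / 2 then kappa else 1 - 1 / (4 * kappa).

Lemma stepsize_itv (kappa : R) : 0 <= kappa -> 0 < stepsize kappa <= 1.
Proof.
rewrite /stepsize; have [_ _|k0 kge0] := eqVneq kappa 0; first by rewrite ltr01 lexx.
have kgt0 : 0 < kappa by rewrite lt_neqAle eq_sym k0.
by rewrite lt_min ltr01 ge_min lexx orbT !andbT divr_gt0// mulr_gt0.
Qed.

Lemma rho_itv (kappa : R) : 0 <= kappa -> 0 <= rho kappa < 1.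
Proof.
rewrite /rho => k0; case: ifPn => [k1|]; first by apply/andP; split; lra.
rewrite -ltNge => k1; have k4 : 0 < 4 * kappa by lra.
have : 1 / (4 * kappa) <= 1 by rewrite ler_pdivrMr//; lra.
have : 0 < 1 / (4 * kappa) by rewrite divr_gt0.
by move=> ? ?; apply/andP; split; lra.
Qed.

End Rate.

(* Main.v *)
Require Import Defs.
From HB Require Import structures.
From mathcomp Require Import all_boot all_order all_algebra.
From mathcomp Require Import all_classical all_reals all_analysis.
From mathcomp Require Import ring lra.
Import Order.TTheory GRing.Theory Num.Theory.
Import numFieldNormedType.Exports.
Import VectorInternalTheory.

Set Implicit Arguments.
Unset Strict Implicit.
Unset Printing Implicit Defensive.

Local Open Scope classical_set_scope.
Local Open Scope ring_scope.

(** The rate comes from a one-step contraction of the duality gap (lemma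
    [gfw_step_le]): for every step size [a] in (0, 1],

      gap(x', y') <= (1 - a + kappa a^2) gap(x, y),

    and for the prescribed step size the factor is [rho kappa]
    ([stepsize_rho]): it minimizes the factor over (0, 1].

    Write [g] for the gradient of [f] at [A x] and [v] for the minimizer of
    [y \o A + h], so that [h^*(- A^* y) = - y (A v) - h v].  The gap splits into
    two Fenchel-Young gaps,

      D1 = f (A x) + f^* y - y (A x)  and  D2 = h x + y (A x) - (h v + y (A v)).

    Each of the four terms of the new gap is bounded by an expression in the old
    point that is affine in [a], up to a quadratic correction:
    - [f (A x')] by the descent lemma, with error [L/2 a^2 |A (v - x)|^2];
    - [f^* y'] by convexity of [f^*] and the equality case
      [f^* g = g (A x) - f (A x)], which is the gradient inequality for [f];
    - [h x'] by strong convexity, with a gain [mu/2 a (1 - a) |v - x|^2];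
    - [h^*(- A^* y')] by smoothness of [h^*], with an error in [y - g].
    The affine parts add up to [(1 - a) (D1 + D2)].  Strong convexity
    of [h] gives [mu/2 |x - v|^2 <= D2] ([argmin_growth]), so the error of the
    descent lemma is at most [kappa a^2 D2]; the error in [y - g] is at most
    [kappa a^2 D1], because smoothness of [f] makes [f^*] strongly convex.

    The last estimate is carried out without the norm of [y - g].  Smoothness of
    [f] gives [y d - g d - L/2 |d|^2 <= D1] for all [d]
    ([smooth_conjugate_gap]), and this is applied directly with [d] a suitable
    multiple of [A (w - v)] inside the supremum over [w] that defines
    [h^*(- A^* y')] ([dual_step_young]).

    The suprema [opnorm A] and [dualnorm y] dominate the values of [A] and [y]
    only because linear maps on a finite-dimensional space are bounded for
    every norm; this is proved by comparing the norm with the sup-norm of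
    coordinates, on the compact unit sphere of the latter ([linear_bounded]). *)

(** * Linear maps on finite-dimensional normed spaces *)

Lemma linear_rV_bounded (R : realType) (V : normedModType R) n
    (l : {linear 'rV[R]_n -> V}) :
  exists2 K : R, 0 <= K & forall r, `|l r| <= K * `|r|.
Proof.
exists (\sum_i `|l (delta_mx 0 i)|) => [|r]; first exact: sumr_ge0.
rewrite {1}(row_sum_delta r) linear_sum mulr_suml.
apply: (le_trans (ler_norm_sum _ _ _)); apply: ler_sum => i _.
rewrite linearZ normrZ mulrC ler_wpM2l//.
rewrite [leRHS]mx_normrE; exact: (le_bigmax _ _ (0, i)).
Qed.

(** The continuous function [`|l r|] has a positive minimum on the compact unit
    sphere of ['rV_n]; homogeneity extends the bound to all vectors. *)
Lemma injective_linear_rV_lower_bound (R : realType) (V : normedModType R) n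
    (l : {linear 'rV[R]_n -> V}) : injective l ->
  exists2 m : R, 0 < m & forall r, m * `|r| <= `|l r|.
Proof.
move=> l_inj; have [K K0 lK] := linear_rV_bounded l.
have l_cont : continuous l.
  apply: bounded_linear_continuous; apply/linear_boundedP; exists K.
  split; first exact: num_real.
  move=> r Kr x.
  by apply: (le_trans (lK x)); rewrite ler_wpM2r// ltW.
pose S := [set r : 'rV[R]_n | `|r| = 1].
have unitS r : r != 0 -> S (`|r|^-1 *: r).
  by move=> r0; rewrite /S/= normrZ normfV normr_id mulVf// normr_eq0.
have [S0|S0] := eqVneq S set0.
  exists 1 => // r; have [->|/unitS] := eqVneq r 0; last by rewrite S0.
  by rewrite normr0 mulr0.
have S_compact : compact S.
  apply: bounded_closed_compact.
    by exists 1; split; [exact: num_real|move=> M M1 r /= ->; exact: ltW].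
  rewrite (_ : S = (fun r => `|r|) @^-1` [set 1])//.
  by apply: preimage_closed => [r _|]; [exact: norm_continuous|exact: closed_eq].
have [||c] := compact_EVT_min (f := fun r => `|l r|) _ S_compact.
- exact/set0P.
- apply: continuous_subspaceT => r.
  by apply: continuous_comp; [exact: l_cont|exact: norm_continuous].
rewrite inE => Sc c_min; exists `|l c|.
  rewrite normr_gt0; apply: contra_eq_neq Sc => /eqP.
  by rewrite -(linear0 l) => /eqP/l_inj ->; rewrite normr0 eq_sym oner_eq0.
move=> r; have [->|r0] := eqVneq r 0; first by rewrite normr0 mulr0.
have /c_min : `|r|^-1 *: r \in S by rewrite inE; exact: unitS.
rewrite linearZ normrZ normfV normr_id.
by rewrite ler_pdivlMl ?normr_gt0// mulrC.
Qed.

(** Equivalence of norms in disguise: the coordinate isomorphism [r2v] is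
    bounded below, so a bound in terms of coordinates transfers to the norm of
    [X]. *)
Lemma linear_bounded (R : realType) (X : finNormedModType R)
    (V : normedModType R) (g : {linear X -> V}) :
  exists2 C : R, 0 <= C & forall x, `|g x| <= C * `|x|.
Proof.
have [m m0 rm] :=
  injective_linear_rV_lower_bound (l := r2v) (can_inj (@r2vK _ X)).
have [K K0 gK] := linear_rV_bounded (g \o (r2v : 'rV[R]_(dim X) -> X)).
exists (K / m); first by rewrite divr_ge0 // ltW.
move=> x; have := gK (v2r x); rewrite /= v2rK => /le_trans; apply.
rewrite -mulrA ler_wpM2l// ler_pdivlMl//.
by have := rm (v2r x); rewrite /= v2rK.
Qed.

Lemma ler_opnorm (R : realType) (X U : finNormedModType R) (A : 'Hom(X, U)) x :
  `|A x| <= opnorm A * `|x|.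
Proof.
have [->|x0] := eqVneq x 0; first by rewrite linear0 !normr0 mulr0.
have [C C0 AC] := linear_bounded A.
rewrite -ler_pdivrMr ?normr_gt0//.
have -> : `|A x| / `|x| = `|A (`|x|^-1 *: x)|.
  by rewrite linearZ normrZ normfV normr_id mulrC.
apply: ub_le_sup; last first.
  exists (`|x|^-1 *: x) => //=.
  by rewrite normrZ normfV normr_id mulVf// normr_eq0.
by exists C => _ [z /= z1 <-]; rewrite (le_trans (AC z))// z1 mulr1.
Qed.

Lemma opnorm_ge0 (R : realType) (X U : finNormedModType R) (A : 'Hom(X, U)) :
  0 <= opnorm A.
Proof.
rewrite /opnorm; set S := [set x : X | `|x| = 1].
have [->|/set0P[x Sx]] := eqVneq S set0; first by rewrite image_set0 sup0.
by have := ler_opnorm A x; rewrite Sx mulr1; exact: le_trans.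
Qed.

Lemma ler_dualnorm (R : realType) (U : finNormedModType R)
    (y : 'Hom(U, R^o)) u :
  y u <= dualnorm y * `|u|.
Proof.
have [->|u0] := eqVneq u 0; first by rewrite linear0 normr0 mulr0.
have [C C0 yC] := linear_bounded (y : {linear U -> R^o}).
rewrite -ler_pdivrMr ?normr_gt0//.
have -> : y u / `|u| = y (`|u|^-1 *: u).
  by rewrite linearZ mulrC.
apply: ub_le_sup; last first.
  exists (`|u|^-1 *: u) => //=.
  by rewrite normrZ normfV normr_id mulVf// normr_eq0.
exists C => _ [z /= z1 <-]; rewrite (le_trans (ler_norm _))//.
by rewrite (le_trans (yC z))// ler_piMr.
Qed.

(** * Smooth convex functions *)

(** The limit [l -> 0+] in an inequality with a loss linear in [l]. *)
Lemma ler_of_linear_losses (R : realType) (K c d : R) : 0 <= K ->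
  (forall l, 0 < l <= 1 -> c - l * K <= d) -> c <= d.
Proof.
move=> K0 loss; apply/ler_addgt0Pr => e e0.
(* The parameter [l = e / (K + e)] is admissible and costs at most [e]. *)
have K1 : 0 < K + e by lra.
have : e / (K + e) * K <= e by rewrite mulrAC ler_pdivrMr// ler_pM2l//; lra.
have : 0 < e / (K + e) <= 1 by rewrite divr_gt0//= ler_pdivrMr//; lra.
by move=> /loss; lra.
Qed.

(** Comparison of [phi] with the parabola that has the same value and slope at
    [0] and second derivative [K]: their difference is nonincreasing. *)
Lemma taylor1_le (R : realType) (phi dphi : R -> R) (K : R) :
  (forall t, is_derive t (1 : R) phi (dphi t)) ->
  (forall t, 0 <= t -> dphi t <= dphi 0 + K * t) ->
  phi 1 <= phi 0 + dphi 0 + K / 2.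
Proof.
move=> phi_der dphi_le.
pose psi : R -> R := phi - (dphi 0 \*: id) - ((K / 2) \*: id ^+ 2).
have psi_der t : is_derive t (1 : R) psi (dphi t - dphi 0 - K * t).
  have := phi_der t => ?; apply: is_derive_eq.
  by rewrite /= /GRing.scale/= !mulr1 expr1; field.
have psi_cont : {within `[0, 1], continuous psi}.
  apply: continuous_subspaceT => t.
  by apply/differentiable_continuous/derivable1_diffP; have [] := psi_der t.
have [c c01 psiE] := MVT ltr01 (fun t _ => psi_der t) psi_cont.
have : psi 1 - psi 0 <= 0.
  rewrite psiE subr0 mulr1.
  have /dphi_le : 0 <= c by move: c01; rewrite in_itv/= => /andP[/ltW].
  by lra.
rewrite /psi !fctE /= /GRing.scale/= expr1n expr0n/=; lra.
Qed.

Section Smooth.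
Variables (R : realType) (U : finNormedModType R) (L : R) (f : U -> R^o).
Hypothesis L_gt0 : 0 < L.
Hypothesis f_smooth : smooth L f.

Lemma gradientE u d : gradient f u d = 'd f u d.
Proof. exact: lfunE. Qed.

Lemma is_derive_line u d t :
  is_derive (t : R) (1 : R) (fun s : R => f (u + s *: d) : R)
    (gradient f (u + t *: d) d).
Proof.
have df := f_smooth.1 (u + t *: d).
rewrite gradientE -deriveE//.
have quotE :
  (fun h : R => h^-1 *: ((f (u + (h *: 1 + t) *: d) : R^o) - f (u + t *: d))) =
  (fun h : R => h^-1 *: (f (h *: d + (u + t *: d)) - f (u + t *: d))).
  by apply/funext => h; rewrite [h *: 1]mulr1 scalerDl addrCA.
have := diff_derivable (v := d) df.
by split; rewrite /derivable /derive /= quotE.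
Qed.

Lemma gradient_lip u v d :
  (gradient f u d : R) - gradient f v d <= L * `|u - v| * `|d|.
Proof.
have -> : gradient f u d - gradient f v d = (gradient f u - gradient f v) d.
  by rewrite add_lfunE opp_lfunE.
apply: (le_trans (ler_dualnorm _ _)); rewrite ler_wpM2r//.
exact: f_smooth.2.
Qed.

Lemma descent u w :
  (f w : R) <= (f u : R) + gradient f u (w - u) + L / 2 * `|w - u| ^+ 2.
Proof.
set d := w - u.
have udE : u + 1 *: d = w by rewrite scale1r addrC subrK.
have line_der t : is_derive (t : R) (1 : R) (fun s : R => f (u + s *: d) : R)
  (gradient f (u + t *: d) d : R) := is_derive_line u d t.
have := taylor1_le line_der (K := L * `|d| ^+ 2).
rewrite udE scale0r addr0 mulrAC; apply => t t0.
have := gradient_lip (u + t *: d) u d.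
rewrite addrAC subrr add0r normrZ ger0_norm//; lra.
Qed.

(** Convexity of [f] would give this without the quadratic term; it serves to
    prove that inequality. *)
Lemma descent_low u w :
  (f u : R) + gradient f u (w - u) - L / 2 * `|w - u| ^+ 2 <= f w.
Proof.
set d := w - u.
have udE : u + 1 *: d = w by rewrite scale1r addrC subrK.
have line_der t :
  is_derive (t : R) (1 : R) (- (fun s : R => f (u + s *: d) : R))
  (- (gradient f (u + t *: d) d : R)).
  by have := is_derive_line u d t => ?; exact: is_deriveN.
suff : - (f w : R) <= - (f u : R) - gradient f u d + L / 2 * `|d| ^+ 2 by lra.
have := taylor1_le line_der (K := L * `|d| ^+ 2).
rewrite !fctE udE scale0r addr0 mulrAC; apply => t t0.
have := gradient_lip u (u + t *: d) d.
rewrite distrC addrAC subrr add0r normrZ ger0_norm//; lra.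
Qed.

(** Comparing the chord of [f] from [u] to [w] with [descent_low] at the point
    [u + t *: d] gives the inequality up to a loss proportional to [t]. *)
Lemma convex_gradient_le :
  convex_function (setT : set (convex_lmodType U)) f ->
  forall u w, (f u : R) + gradient f u (w - u) <= f w.
Proof.
move=> f_convex u w; set d := w - u.
rewrite addrC -lerBrDr.
apply: (@ler_of_linear_losses _ (L / 2 * `|d| ^+ 2)).
  by rewrite mulr_ge0// divr_ge0// ltW.
move=> t /andP[t0 t1].
have fconv : (f (t *: w + (1 - t) *: u) : R) <= t * (f w : R) + (1 - t) * f u.
  by apply: (f_convex (Itv01 (ltW t0) t1)); rewrite inE.
have := descent_low u (u + t *: d).
have -> : u + t *: d - u = t *: d by rewrite addrAC subrr add0r.
rewrite linearZ normrZ gtr0_norm// exprMn /=.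
have -> : u + t *: d = t *: w + (1 - t) *: u.
  by rewrite /d scalerBr scalerBl scale1r addrCA addrA.
move=> fdesc; rewrite -(ler_pM2l t0).
move: fconv fdesc; rewrite /GRing.scale/=.
set ftw := f _; set N2 := `|d| ^+ 2; set gd := gradient f u d.
by rewrite expr2; lra.
Qed.
End Smooth.

(** * Conjugates and minimizers of strongly convex functions *)

Section Conjugate.
Variables (R : realType) (X : finNormedModType R) (h : X -> \bar R).
Hypothesis h_gtNy : forall x, (-oo < h x)%E.
Implicit Types (x v : X) (z : 'Hom(X, R^o)).

Lemma edom_EFin x : edom h x -> h x = (fine (h x))%:E.
Proof. by move=> hx; rewrite fineK// fin_real// h_gtNy. Qed.

Lemma conjugate_le z (c : R) :
  (forall x, edom h x -> (z x : R) - fine (h x) <= c) ->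
  (conjugate h z <= c%:E)%E.
Proof.
move=> zc; apply: ge_ereal_sup => _ [x hx <-].
by rewrite (edom_EFin hx) -EFinB lee_fin zc.
Qed.

Lemma conjugate_fin_ge z : edom h !=set0 -> edom (conjugate h) z ->
  conjugate h z = (fine (conjugate h z))%:E /\
  forall x, edom h x -> (z x : R) - fine (h x) <= fine (conjugate h z).
Proof.
move=> [x0 hx0] hz.
have ub x : edom h x -> (((z x : R) - fine (h x))%:E <= conjugate h z)%E.
  move=> hx; apply: ereal_sup_ubound; exists x => //.
  by rewrite EFinB -edom_EFin.
have fz : conjugate h z = (fine (conjugate h z))%:E.
  by rewrite fineK// fin_real// (lt_le_trans _ (ub _ hx0))// ltNyr.
by split=> // x hx; rewrite -lee_fin -fz ub.
Qed.

Lemma strongly_convex_fine (mu : R) x w (l : R) : strongly_convex mu h ->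
  edom h x -> edom h w -> 0 <= l <= 1 ->
  edom h (l *: x + (1 - l) *: w) /\
  fine (h (l *: x + (1 - l) *: w)) <= l * fine (h x) + (1 - l) * fine (h w)
     - mu / 2 * l * (1 - l) * `|x - w| ^+ 2.
Proof.
move=> h_sc hx hw l01; have hl := h_sc x w l hx hw l01.
rewrite (edom_EFin hx) (edom_EFin hw) -!EFinM -EFinD in hl.
have hd : edom h (l *: x + (1 - l) *: w) by exact: le_lt_trans hl (ltry _).
by split=> [//|]; rewrite -lee_fin -edom_EFin.
Qed.

Section Argmin.
Variables (z : 'Hom(X, R^o)) (v : X).
Hypothesis v_min : argmin (fun x => (z x : R)%:E + h x)%E v.

Lemma argmin_dom x : edom h x -> edom h v.
Proof.
move=> hx; have := v_min x; rewrite (edom_EFin hx) -EFinD /edom/=.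
by case: (h v) => [r _| |//]; rewrite ?ltry.
Qed.

Lemma argmin_fine_le x : edom h x ->
  (z v : R) + fine (h v) <= (z x : R) + fine (h x).
Proof.
move=> hx; have := v_min x.
by rewrite (edom_EFin hx) (edom_EFin (argmin_dom hx)) -!EFinD lee_fin.
Qed.

(** The supremum that defines [h^*] at [- z] is attained at [v]. *)
Lemma conjugate_argmin x : edom h x ->
  conjugate h (- z) = (- ((z v : R) + fine (h v)))%:E.
Proof.
move=> hx; have hv := argmin_dom hx.
apply/eqP; rewrite eq_le; apply/andP; split.
  apply: conjugate_le => w hw; rewrite opp_lfunE.
  by have := argmin_fine_le hw; lra.
apply: ereal_sup_ubound; exists v => //.
by rewrite opprD EFinB -edom_EFin// opp_lfunE.
Qed.

(** Strong convexity is used between [v] and [l *: x + (1 - l) *: v]; after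
    division by [l], the quadratic term is lost only up to a multiple of [l]. *)
Lemma argmin_growth (mu : R) x : 0 < mu -> strongly_convex mu h -> edom h x ->
  (z v : R) + fine (h v) + mu / 2 * `|x - v| ^+ 2 <= (z x : R) + fine (h x).
Proof.
move=> mu0 h_sc hx; have hv := argmin_dom hx.
set K := mu / 2 * `|x - v| ^+ 2.
have K0 : 0 <= K by rewrite mulr_ge0// divr_ge0// ltW.
apply: (ler_of_linear_losses K0) => l.
move=> /andP[l0 l1]; have l01 : 0 <= l <= 1 by rewrite ltW.
have [hm hmle] := strongly_convex_fine h_sc hx hv l01.
have zE : z (l *: x + (1 - l) *: v) = l * (z x : R) + (1 - l) * z v.
  by rewrite linearD !linearZ.
have := argmin_fine_le hm; rewrite zE => zm.
rewrite -(ler_pM2l l0).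
have : mu / 2 * l * (1 - l) * `|x - v| ^+ 2 = l * ((1 - l) * K).
  by rewrite /K; ring.
lra.
Qed.
End Argmin.
End Conjugate.

(** * One step of the method *)

(** This is the strong convexity of the conjugate of an [L]-smooth function: the
    supremum over [d] of the left-hand side is, for [L > 0],
    [dualnorm (y - g) ^+ 2 / (2 * L)], with [g] the gradient at [u]. *)
Lemma smooth_conjugate_gap (R : realType) (U : finNormedModType R) (L : R)
    (f : U -> R^o) (y : 'Hom(U, R^o)) (F : R) u :
  smooth L f -> (forall w, (y w : R) - f w <= F) ->
  forall d, (y d : R) - gradient f u d - L / 2 * `|d| ^+ 2 <=
    (f u : R) + F - y u.
Proof.
move=> f_smooth yF d; have := descent f_smooth u (u + d).
have -> : u + d - u = d by rewrite addrAC subrr add0r.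
by have := yF (u + d); rewrite linearD/=; lra.
Qed.

Section Step.
Variables (R : realType) (X U : finNormedModType R) (A : 'Hom(X, U)).
Variables (L mu : R) (f : U -> R^o) (h : X -> \bar R).
Hypothesis L_gt0 : 0 < L.
Hypothesis mu_gt0 : 0 < mu.
Hypothesis f_convex : convex_function (setT : set (convex_lmodType U)) f.
Hypothesis f_smooth : smooth L f.
Hypothesis h_gtNy : forall x, (-oo < h x)%E.
Hypothesis h_sc : strongly_convex mu h.

Let kappa := condition_number L mu A.

Lemma condition_number_ge0 : 0 <= kappa.
Proof.
rewrite /kappa /condition_number divr_ge0 ?mulr_ge0 ?exprn_ge0 ?opnorm_ge0//.
  exact: ltW.
exact: ltW.
Qed.

Lemma smooth_opnorm_le (e : X) :
  L * `|A e| ^+ 2 <= kappa * mu * `|e| ^+ 2.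
Proof.
rewrite /kappa /condition_number divfK ?gt_eqF// -mulrA ler_pM2l// -exprMn.
by rewrite lerXn2r ?nnegrE ?mulr_ge0 ?opnorm_ge0// ler_opnorm.
Qed.

(** Young's inequality for the pairing of [y - g] with [A e], where the first
    square is measured by the Fenchel-Young gap of [f]. *)
Lemma dual_step_young (y : 'Hom(U, R^o)) (F alpha : R) u (e : X) :
  0 < alpha -> (forall w, (y w : R) - f w <= F) ->
  alpha * ((y (A e) : R) - gradient f u (A e)) <=
    alpha ^+ 2 * kappa * ((f u : R) + F - y u) + mu / 2 * `|e| ^+ 2.
Proof.
move=> alpha0 yF; have Ae := smooth_opnorm_le e.
have gap := smooth_conjugate_gap u f_smooth yF.
(* The multiple of [A e] used below degenerates when [A = 0]. *)
have [k0|k0] := eqVneq kappa 0.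
  have -> : A e = 0.
    apply/eqP; rewrite -normr_eq0 -sqrf_eq0 eq_le sqr_ge0 andbT.
    by rewrite -(pmulr_rle0 _ L_gt0) (le_trans Ae)// k0 !mul0r.
  rewrite !linear0 addr0 mulr0 k0 mulr0 mul0r add0r.
  by rewrite mulr_ge0// divr_ge0// ltW.
have kpos : 0 < kappa by rewrite lt_neqAle eq_sym k0 condition_number_ge0.
(* This scaling of [A e] turns the quadratic term into [mu / 2 * `|e| ^+ 2]. *)
set c := (alpha * kappa)^-1.
have ak0 : 0 < alpha * kappa by rewrite mulr_gt0.
have c0 : 0 < c by rewrite invr_gt0.
have := gap (c *: A e).
rewrite [y _]linearZ [gradient f u _]linearZ normrZ gtr0_norm//.
rewrite exprMn /GRing.scale/= -(ler_pM2l (mulr_gt0 alpha0 ak0)).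
set n := `|e| ^+ 2 in Ae *; set a := `|A e| ^+ 2 in Ae *.
set D : R := (f u : R) + F - y u.
set yA := y (A e); set gA := gradient f u (A e).
have -> : alpha * (alpha * kappa) * (c * yA - c * gA - L / 2 * (c ^+ 2 * a))
    = alpha * (yA - gA) - alpha * c / 2 * (L * a).
  by rewrite /c; field; rewrite k0 gt_eqF.
have : alpha * c / 2 * (L * a) <= mu / 2 * n.
  have -> : mu / 2 * n = alpha * c / 2 * (kappa * mu * n).
    by rewrite /c; field; rewrite k0 gt_eqF.
  by rewrite ler_wpM2l// divr_ge0// mulr_ge0// ltW.
lra.
Qed.

(** Invariance of the two domains makes all four terms of the gap finite, so
    that the estimate takes place in [R]. *)
Lemma gfw_step_le (alpha : R) (x v : X) (y : 'Hom(U, R^o)) :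
  0 < alpha <= 1 ->
  edom h x -> edom (conjugate (EFin \o f)) y ->
  argmin (fun x' : X => (adjoint A y x' : R)%:E + h x')%E v ->
  let x1 := x + alpha *: (v - x) in
  let y1 := (1 - alpha) *: y + alpha *: gradient f (A x) in
  [/\ edom h x1, edom (conjugate (EFin \o f)) y1 &
  (duality_gap A f h x1 y1 <=
    (1 - alpha + kappa * alpha ^+ 2)%:E * duality_gap A f h x y)%E].
Proof.
move=> /andP[a0 a1] hx hy v_min x1 y1.
have adjE (z : 'Hom(U, R^o)) w : adjoint A z w = z (A w) by rewrite comp_lfunE.
have f_gtNy u : (-oo < (EFin \o f) u)%E by rewrite ltNyr.
have f_dom u : edom (EFin \o f) u by rewrite /edom/= ltry.
set g := gradient f (A x) in y1 *.
have hv := argmin_dom h_gtNy v_min hx.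
have [yF_fin yF] := conjugate_fin_ge f_gtNy (ex_intro _ 0 (f_dom 0)) hy.
set F := fine _ in yF_fin yF.
have {}yF w : (y w : R) - f w <= F := yF w (f_dom w).
have y1E w : y1 w = (1 - alpha) * (y w : R) + alpha * g w.
  by rewrite add_lfunE !scale_lfunE.
have fy1 : (conjugate (EFin \o f) y1 <=
    ((1 - alpha) * F + alpha * ((g (A x) : R) - f (A x)))%:E)%E.
  apply: conjugate_le => // w _ /=; rewrite y1E.
  have := convex_gradient_le L_gt0 f_smooth f_convex (A x) w.
  rewrite -/g linearB/= => gw.
  have : (1 - alpha) * ((y w : R) - f w) <= (1 - alpha) * F.
    by rewrite ler_wpM2l// subr_ge0.
  have : alpha * ((g w : R) - f w) <= alpha * ((g (A x) : R) - f (A x)).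
    by rewrite ler_pM2l//; lra.
  lra.
have hy1 : edom (conjugate (EFin \o f)) y1 by exact: le_lt_trans fy1 (ltry _).
set a := fine (h x); set b := fine (h v); set N : R := `|x - v| ^+ 2.
have [hx1 hx1le] : edom h x1 /\
    fine (h x1) <= alpha * b + (1 - alpha) * a
      - mu / 2 * alpha * (1 - alpha) * N.
  have -> : x1 = alpha *: v + (1 - alpha) *: x.
    by rewrite /x1 scalerBr scalerBl scale1r addrCA.
  rewrite /N distrC; apply: strongly_convex_fine => //.
  by rewrite ltW.
have hconj := conjugate_argmin h_gtNy v_min hx.
have D2 := argmin_growth h_gtNy v_min mu_gt0 h_sc hx.
rewrite adjE -/a -/b -/N in hconj D2; rewrite adjE in D2.
pose D1 : R := (f (A x) : R) + F - y (A x).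
have hy1conj : (conjugate h (- adjoint A y1)%R <=
   (- ((y (A v) : R) + b) - alpha * ((g (A v) : R) - y (A v))
     + alpha ^+ 2 * kappa * D1)%:E)%E.
  apply: conjugate_le => // w hw; rewrite opp_lfunE adjE y1E.
  have := argmin_growth h_gtNy v_min mu_gt0 h_sc hw; rewrite !adjE -/b => gr.
  (* The growth of [h] away from [v] absorbs the quadratic term in [w - v]. *)
  have := dual_step_young (A x) (w - v) a0 yF.
  have AB (z : 'Hom(U, R^o)) : z (A (w - v)) = (z (A w) : R) - z (A v).
    by rewrite !linearB.
  rewrite -/D1 -/g !AB; lra.
have fx1 : (f (A x1) : R) <= (f (A x) : R) + alpha * ((g (A v) : R) - g (A x))
    + kappa * alpha ^+ 2 * (mu / 2 * N).
  have := descent f_smooth (A x) (A x1).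
  have -> : A x1 - A x = alpha *: A (v - x).
    by rewrite /x1 linearD linearZ/= addrAC subrr add0r.
  have nAe : `|alpha *: A (v - x)| ^+ 2 = alpha ^+ 2 * `|A (v - x)| ^+ 2 :> R.
    by rewrite normrZ gtr0_norm// exprMn.
  have gAe : g (alpha *: A (v - x)) = alpha * ((g (A v) : R) - g (A x)).
    by rewrite linearZ !linearB.
  have : alpha ^+ 2 * (L * `|A (v - x)| ^+ 2) <= alpha ^+ 2 * (kappa * mu * N).
    by rewrite ler_wpM2l ?sqr_ge0// /N distrC smooth_opnorm_le.
  rewrite nAe gAe; lra.
split=> //.
rewrite /duality_gap (edom_EFin h_gtNy hx)
  (edom_EFin h_gtNy hx1) yF_fin hconj -/a.
rewrite -!EFinD -EFinM.
apply: (le_trans (leeD (leeD (lexx _) fy1) hy1conj)); rewrite -!EFinD lee_fin.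
have k0 := condition_number_ge0.
(* The gain from strong convexity of [h] is dropped: only its sign matters. *)
have N0 : 0 <= N by exact: sqr_ge0.
have : 0 <= mu / 2 * alpha * (1 - alpha) * N.
  by rewrite mulr_ge0// mulr_ge0 ?subr_ge0// mulr_ge0 ?divr_ge0// ltW.
have : kappa * alpha ^+ 2 * (mu / 2 * N) <=
    kappa * alpha ^+ 2 * (a + (y (A x) : R) - ((y (A v) : R) + b)).
  by rewrite ler_wpM2l// ?(mulr_ge0 k0 (sqr_ge0 alpha))//; lra.
by move: hx1le fx1; rewrite /D1; lra.
Qed.
End Step.

(** * The rate *)

Lemma stepsize_rho (R : realType) (kappa : R) : 0 <= kappa ->
  1 - stepsize kappa + kappa * stepsize kappa ^+ 2 = rho kappa.
Proof.
move=> k0; rewrite /stepsize /rho.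
have [->|kn0] := eqVneq kappa 0.
  by rewrite subrr mul0r addr0 divr_ge0.
have kpos : 0 < kappa by rewrite lt_neqAle eq_sym kn0.
case: ifPn => k12.
  rewrite min_r; first by rewrite expr1n subrr add0r mulr1.
  by rewrite ler_pdivlMr ?mulr_gt0//; lra.
rewrite min_l; first by field.
by rewrite ler_pdivrMr ?mulr_gt0//; lra.
Qed.

Theorem theorem3p1 (R : realType) (X U : finNormedModType R)
    (A : 'Hom(X, U)) (L mu : R) (f : U -> R^o) (h : X -> \bar R)
    (L_gt0 : 0 < L) (mu_gt0 : 0 < mu)
    (f_convex : convex_function (setT : set (convex_lmodType U)) f)
    (f_smooth : smooth L f)
    (h_gtNy : forall x, (-oo < h x)%E)
    (h_closed_convex : closed_convex h)
    (h_dom : edom h !=set0)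
    (h_strongly_convex : strongly_convex mu h)
    (x0 : X) (y0 : 'Hom(U, R^o))
    (x0_dom : edom h x0) (y0_dom : edom (conjugate (EFin \o f)) y0)
    (x : nat -> X) (y : nat -> 'Hom(U, R^o))
    (xy_iterates : gfw_dual_averaging A f h
      (fun=> stepsize (condition_number L mu A)) x0 y0 x y) :
  forall t : nat,
    (duality_gap A f h (x t) (y t) <=
       (rho (condition_number L mu A) ^+ t)%:E * duality_gap A f h x0 y0)%E.
Proof.
have [xE yE step] := xy_iterates.
have k0 := condition_number_ge0 A L_gt0 mu_gt0.
move=> t.
suff [] : [/\ edom h (x t), edom (conjugate (EFin \o f)) (y t) &
    (duality_gap A f h (x t) (y t) <=
     (rho (condition_number L mu A) ^+ t)%:E * duality_gap A f h x0 y0)%E].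
  by [].
elim: t => [|t [xt yt gap_t]]; first by rewrite xE yE expr0 mul1e.
have [v [g [v_min -> gE ->]]] := step t; rewrite {}gE.
have [xt1 yt1 gap_t1] := gfw_step_le L_gt0 mu_gt0 f_convex f_smooth h_gtNy
  h_strongly_convex (stepsize_itv k0) xt yt v_min.
split=> //; apply: (le_trans gap_t1); rewrite stepsize_rho//.
rewrite exprS EFinM -muleA lee_wpmul2l// lee_fin.
by case/andP: (rho_itv k0).
Qed.
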